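(* Let $m\ge 1$ and let $K\ne 2^{[m]}$ be a simplicial complex on $[m]$ (ghost vertices allowed) such that the Bier sphere $\mathrm{Bier}(K)$ is flag. Then the $\gamma$-vector $\gamma(\mathrm{Bier}(K))$ is the $f$-vector of a flag simplicial complex. (That is, the Nevo–Petersen conjecture holds in the class of flag Bier spheres.)
   Context: $[m]=\{1,\dots,m\}$, $[m']=\{1',\dots,m'\}$ is a disjoint copy, and for $I\subseteq[m]$, $I'=\{i' : i\in I\}$. A simplicial complex on a set is a collection of its subsets containing $\varnothing$ and closed under taking subsets. It is flag if all its minimal non-faces (inclusion-minimal subsets of the ground set that are not faces) have cardinality $\le 2$ (ghost vertices, i.e. minimal non-faces of cardinality 1, are allowed). For $K\ne 2^{[m]}$ the Alexander dual is the simplicial complex on $[m']$ given by $K^\vee=\{J' : J\subseteq [m],\ [m]\setminus J\notin K\}$, and the Bier sphere is the simplicial complex on $[m]\sqcup[m']$ $$\mathrm{Bier}(K)=\{I\sqcup J' : I\in K,\ J'\in K^\vee,\ I\cap J=\varnothing\},$$ a sphere of dimension $m-2$. For an $(n-1)$-dimensional simplicial complex $L$, the $f$-vector is $(f_{-1},f_0,\dots,f_{n-1})$, where $f_i$ is the number of $i$-dimensional faces ($f_{-1}=1$). The $h$-vector $(h_0,\dots,h_n)$ is defined by $h_0t^n+\dots+h_{n-1}t+h_n=(t-1)^n+f_0(t-1)^{n-1}+\dots+f_{n-1}$. If the $h$-vector is symmetric (as is the case for simplicial spheres), the $\gamma$-vector $\gamma(L)=(\gamma_0,\dots,\gamma_{\lfloor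 n/2\rfloor})$ is defined by $h_0+h_1t+\dots+h_nt^n=\sum_{i=0}^{\lfloor n/2\rfloor}\gamma_it^i(1+t)^{n-2i}$. ''The $\gamma$-vector is the $f$-vector of a complex $\Gamma$'' means $\gamma_i=f_{i-1}(\Gamma)$ for all $i$, where trailing zeros are ignored (both sequences are extended by zeros). *)

(* Defs.v *)
From mathcomp Require Import all_boot all_order all_algebra.
Set Implicit Arguments.
Unset Strict Implicit.
Unset Printing Implicit Defensive.
Import GRing.Theory.

(* Simplicial complexes are identified with their sets of faces; elements of
   the ground type V that are not vertices are ghost vertices. *)
Definition simplicial_complex (V : finType) (L : {set {set V}}) : Prop :=
  set0 \in L /\ forall F G : {set V}, F \subset G -> G \in L -> F \in L.

Definition minimal_nonface (V : finType) (L : {set {set V}}) (F : {set V}) :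
  bool := minset (fun G : {set V} => G \notin L) F.

Definition flag_complex (V : finType) (L : {set {set V}}) : Prop :=
  simplicial_complex L /\
  forall F : {set V}, minimal_nonface L F -> #|F| <= 2.

(* A face J' of the dual is represented by the subset J of [m]; the copy [m']
   of [m] is realized as the right summand of the ground type of bier K. *)
Definition alexander_dual (m : nat) (K : {set {set 'I_m}}) :
  {set {set 'I_m}} := [set J : {set 'I_m} | ~: J \notin K].

Definition bier (m : nat) (K : {set {set 'I_m}}) :
  {set {set ('I_m + 'I_m)%type}} :=
  [set (inl @: I :|: inr @: J) | I : {set 'I_m} in K,
     J : {set 'I_m} in alexander_dual K & [disjoint I & J]].

(* fnum L k is f_(k-1): a face of dimension k-1 has k elements. *)
Definition fnum (V : finType) (L : {set {set V}}) (k : nat) : nat :=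
  #|[set F in L | #|F| == k]|.

(* dim L + 1, so that rank L is the n of the h- and gamma-vectors. *)
Definition rank (V : finType) (L : {set {set V}}) : nat :=
  \max_(F in L) #|F|.

Local Open Scope ring_scope.

Definition h_num (V : finType) (L : {set {set V}}) (i : nat) : int :=
  let n := rank L in
  (\sum_(k < n.+1) (fnum L k)%:R *: ('X - 1) ^+ (n - k) : {poly int})`_(n - i).

(* g is the gamma-vector of L, extended by zeros. The h-vector of L is symmetric
   as soon as such a g exists, and g is then unique (gamma_vector_uniq). *)
Definition gamma_vector (V : finType) (L : {set {set V}}) (g : nat -> int) :
  Prop :=
  let n := rank L in
  (\sum_(i < n.+1) h_num L i *: 'X^i =
     \sum_(i < n./2.+1) g i *: ('X^i * (1 + 'X) ^+ (n - i.*2)) :> {poly int}) /\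
  (forall i : nat, (n./2 < i)%N -> g i = 0).

Lemma gamma_vector_uniq (V : finType) (L : {set {set V}}) (g1 g2 : nat -> int) :
  gamma_vector L g1 -> gamma_vector L g2 -> g1 =1 g2.
Proof.
set n := rank L => -[e1 z1] [e2 z2]; elim/ltn_ind => j IHj.
case: (ltnP n./2 j) => [lt_j|le_j]; first by rewrite z1 // z2.
have := congr1 (fun p : {poly int} => p`_j) (etrans (esym e1) e2).
rewrite /= !coef_sum -/n.
rewrite !(bigD1 (P := xpredT) (Ordinal (le_j : j < n./2.+1)%N)) //=.
rewrite !coefZ coefXnM ltnn subnn.
have -> : ((1 + 'X : {poly int}) ^+ (n - j.*2))`_0 = 1.
  by rewrite -horner_coef0 horner_exp !hornerE expr1n.
rewrite !mulr1; set s1 := \sum_(i < _ | _) _; set s2 := \sum_(i < _ | _) _.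
suff -> : s1 = s2 by move/addIr.
apply: eq_bigr => i ne_ij; rewrite !coefZ coefXnM.
case: (ltngtP j i) => [_|lt_ij|eq_ij]; first by rewrite !mulr0.
  by rewrite (IHj _ lt_ij).
by case/eqP: ne_ij; apply: val_inj; rewrite /= eq_ij.
Qed.

(* Main.v *)
Require Import Defs.
From mathcomp Require Import all_boot all_order all_algebra.
From mathcomp Require Import zify ring.
Set Implicit Arguments.
Unset Strict Implicit.
Unset Printing Implicit Defensive.
Import GRing.Theory.

(* A flag Bier sphere forces every non-face of K to contain a non-face with at
   most two elements, and every face of K to avoid some {p, q} whose complement
   is a face.  So K is the independence complex of a graph (with loops at ghost
   vertices) in which every independent set misses a vertex cover with at most
   two elements; choosing covers that avoid suitable vertices shows that K
   depends on at most four elements of [m].  Counting the pairs I <= C with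
   I in K and C not in K gives
     (X - 1) h(X) = \sum_(C in K) (X^(m - #|C|) - X^#|C|),
   and elements on which K does not depend only contribute factors 1 + X.  In
   each of the remaining cases h(X) = (1 + X)^n + g X (1 + X)^(n - 2) with
   n = m - 1 and g = 0, 1 or 2, so g isolated points realize gamma. *)

(** * Weighted sums over the subsets of a finite set *)

Section SubsetSums.
Local Open Scope ring_scope.
Variables (T : finType) (R : comNzRingType).
Implicit Types (U : {set T}) (y z : R).

Lemma sum_subsetD1 (v : T) U (P : pred {set T}) (F : {set T} -> R) :
  v \in U ->
  \sum_(C : {set T} | (C \subset U) && P C) F C =
    \sum_(C : {set T} | (C \subset U :\ v) && P (v |: C)) F (v |: C) +
    \sum_(C : {set T} | (C \subset U :\ v) && P C) F C.
Proof.
move=> vU; rewrite (bigID (fun C : {set T} => v \in C)) /=; congr (_ + _); last first.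
  by apply: eq_bigl => C; rewrite subsetD1 andbAC.
rewrite (reindex_onto (fun C : {set T} => v |: C) (fun C => C :\ v)) /=; last first.
  by move=> C /andP[_ vC]; rewrite setD1K.
apply: eq_bigl => C; rewrite setU11 andbT subUset sub1set vU /= subsetD1.
case: (boolP (v \in C)) => vC /=.
  rewrite andbF; apply/negbTE; rewrite negb_and; apply/orP; right.
  by apply/eqP => eC; move: vC; rewrite -eC !inE eqxx.
by rewrite setU1K // eqxx !andbT.
Qed.

Lemma sum_subset_expr U y z :
  \sum_(C : {set T} | C \subset U) y ^+ #|C| * z ^+ #|U :\: C| = (y + z) ^+ #|U|.
Proof.
have [n] := ubnP #|U|; elim: n U => // n IHn U /ltnSE leUn.
have [->|[v vU]] := set_0Vmem U.
  rewrite (eq_bigl (pred1 set0)) => [|C]; last by rewrite subset0.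
  by rewrite big_pred1_eq setD0 cards0 !expr0 mulr1.
rewrite (eq_bigl (fun C : {set T} => (C \subset U) && true)); last first.
  by move=> C; rewrite andbT.
have cU : #|U| = #|U :\ v|.+1 by rewrite (cardsD1 v) vU.
have ltUn : (#|U :\ v| < n)%N by rewrite -cU.
rewrite (sum_subsetD1 xpredT _ vU) //= cU exprS mulrDl -(IHn _ ltUn) !mulr_sumr.
congr (_ + _); apply: eq_big => C; rewrite ?andbT // subsetD1 => /andP[CU vC].
  by rewrite cardsU1 vC exprS mulrA setDDl.
have -> : U :\: C = v |: ((U :\ v) :\: C).
  apply/setP=> x; rewrite !inE; case: eqP => [->|] //=.
  by rewrite vU vC.
by rewrite cardsU1 !inE eqxx andbF exprS mulrCA.
Qed.

(* k and phi encode a family of subsets of a k-element set by the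
   bit sequences accepted by phi. *)
Fixpoint bit_sum (y z : R) k (phi : seq bool -> bool) : R :=
  if k is k'.+1 then
    y * bit_sum y z k' (phi \o cons true) + z * bit_sum y z k' (phi \o cons false)
  else (phi [::])%:R.

(** Induction on [s] splits the sum by membership of the head. Once [s] is exhausted the condition
    is a constant, and each remaining element of [U] contributes a free factor [y + z]. *)
Lemma sum_subset_support U (s : seq T) phi y z : uniq s -> {subset s <= U} ->
  \sum_(C : {set T} | (C \subset U) && phi [seq x \in C | x <- s])
     y ^+ #|C| * z ^+ #|U :\: C| =
  (y + z) ^+ (#|U| - size s) * bit_sum y z (size s) phi.
Proof.
elim: s U phi => [|v s IHs] U phi /=.
  move=> _ _; rewrite subn0 mulr_natr -sum_subset_expr.
  case: (phi [::]); first by rewrite mulr1n; apply: eq_bigl => C; rewrite andbT.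
  by rewrite mulr0n big_pred0 // => C; rewrite andbF.
move=> /andP[vs us] sU; have vU : v \in U by rewrite sU ?mem_head.
have sUv : {subset s <= U :\ v}.
  move=> x xs; rewrite !inE sU ?inE ?xs ?orbT // andbT.
  by apply: contraNneq vs => <-.
have cU : #|U| = #|U :\ v|.+1 by rewrite (cardsD1 v) vU.
rewrite (sum_subsetD1 _ _ vU) cU subSS mulrDr ![_ ^+ _ * (_ * _)]mulrCA.
rewrite -!(IHs _ _ us sUv) !mulr_sumr.
congr (_ + _); apply: eq_big => C.
- congr (_ && phi _); rewrite /= setU11; congr (_ :: _); apply/eq_in_map => x xs.
  by rewrite !inE; case: eqP xs vs => [->->|].
- rewrite subsetD1 => /andP[/andP[CU vC] _].
  by rewrite cardsU1 vC exprS mulrA setDDl.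
- rewrite subsetD1 /=; case: (boolP (v \in C)) => //=; first by rewrite andbF.
- rewrite subsetD1 => /andP[/andP[CU vC] _].
  have -> : U :\: C = v |: ((U :\ v) :\: C).
    apply/setP=> x; rewrite !inE; case: eqP => [->|] //=.
    by rewrite vU vC.
  by rewrite cardsU1 !inE eqxx andbF exprS mulrCA.
Qed.
End SubsetSums.

(** * Flag complexes and complexes of isolated points *)

Lemma flag_nonface (V : finType) (L : {set {set V}}) (F : {set V}) :
  flag_complex L -> F \notin L ->
  exists u v, [/\ u \in F, v \in F & [set u; v] \notin L].
Proof.
move=> [[L0 _] fl] FL.
have [M minM MF] := minset_exists (P := fun G : {set V} => G \notin L) FL.
have [/= ML _] := minsetP minM.
have := fl M minM; rewrite leq_eqVlt => /orP[/cards2P[u [v [_ eM]]]|].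
  by exists u, v; rewrite -eM; split=> //; apply: (subsetP MF); rewrite eM !inE eqxx ?orbT.
rewrite ltnS leq_eqVlt => /orP[/cards1P[u eM]|]; last first.
  by rewrite ltnS leqn0 cards_eq0 => /eqP eM; rewrite eM L0 in ML.
(* A one-element minimal non-face is a ghost vertex, encoded by [u = v]. *)
exists u, u; rewrite setUid -eM; split=> //; apply: (subsetP MF); by rewrite eM inE.
Qed.

Definition points (g : nat) : {set {set 'I_g}} := [set F : {set 'I_g} | #|F| <= 1].

(** A non-face contains two distinct elements, which already form a non-face, so a minimal one is a
    pair. *)
Lemma points_flag g : flag_complex (points g).
Proof.
split; first split; first by rewrite inE cards0.
  by move=> F G FG; rewrite !inE; apply: leq_trans; apply: subset_leq_card.
move=> F /minsetP[]; rewrite inE -ltnNge => /card_gt1P[u [v [uF vF nuv]]] minF.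
rewrite -(minF [set u; v]) ?cards2 ?nuv ?inE ?cards2 ?nuv //.
by apply/subsetP=> x; rewrite !inE => /orP[] /eqP->.
Qed.

Lemma fnum_points g i :
  fnum (points g) i = if i is i'.+1 then if i' is 0 then g else 0 else 1.
Proof.
case: i => [|[|i]].
- rewrite -(cards1 (set0 : {set 'I_g})); apply: eq_card => F; rewrite !inE cards_eq0.
  by case: eqP => [->|]; rewrite ?cards0 ?andbF.
- transitivity #|[set F : {set 'I_g} | F \subset setT & #|F| == 1]|.
    apply: eq_card => F; rewrite !inE subsetT /=.
    by case: eqP => [->|]; rewrite ?andbF.
  by rewrite cards_draws cardsT card_ord bin1.
- apply: eq_card0 => F; rewrite !inE.
  by apply/negbTE; case: eqP => [->|]; rewrite ?andbF.
Qed.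

(** * Faces of the Bier sphere, and flagness translated to [K] *)

Section Bier.
Variables (m : nat) (K : {set {set 'I_m}}).
Implicit Types I J C : {set 'I_m}.

Definition bier_face (p : {set 'I_m} * {set 'I_m}) : {set 'I_m + 'I_m} :=
  inl @: p.1 :|: inr @: p.2.

Lemma bier_face_inj : injective bier_face.
Proof.
have inlP p x : (inl x \in bier_face p) = (x \in p.1).
  rewrite inE (mem_imset _ _ (@inl_inj _ _)).
  by case: imsetP => [[]|] //; rewrite orbF.
have inrP p x : (inr x \in bier_face p) = (x \in p.2).
  rewrite inE (mem_imset _ _ (@inr_inj _ _)).
  by case: imsetP => [[]|].
move=> [I J] [I' J'] e; congr (_, _); apply/setP => x.
  by rewrite -[LHS](inlP (I, J)) e inlP.
by rewrite -[LHS](inrP (I, J)) e inrP.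
Qed.

(** As an injective image of a set of pairs, the sphere allows sums over its faces to become double
    sums. *)
Lemma bierE : bier K =
  bier_face @: [set p | (p.1 \in K) && ((~: p.2 \notin K) && [disjoint p.1 & p.2])].
Proof.
apply/setP=> F; apply/imset2P/imsetP.
  move=> [I J IK]; rewrite !inE => /andP[JK dIJ] ->.
  by exists (I, J) => //; rewrite inE /= IK JK.
move=> [[I J]]; rewrite inE /= => /and3P[IK JK dIJ] ->.
by exists I J => //; rewrite !inE JK.
Qed.

Lemma mem_bier I J :
  (bier_face (I, J) \in bier K) = [&& I \in K, ~: J \notin K & [disjoint I & J]].
Proof. by rewrite bierE (mem_imset _ _ bier_face_inj) inE. Qed.

Lemma card_setC I : #|~: I| = m - #|I|.
Proof. by rewrite cardsCs setCK card_ord. Qed.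

Lemma card_bier_face I J : #|bier_face (I, J)| = #|I| + #|J|.
Proof.
rewrite cardsU (card_imset _ (@inl_inj _ _)) (card_imset _ (@inr_inj _ _)).
rewrite (_ : _ :&: _ = set0) ?cards0 ?subn0 //.
apply/setP=> x; rewrite !inE; apply/negbTE/negP => /andP[].
by move=> /imsetP[? _ ->] /imsetP[].
Qed.

Section Sum.
Local Open Scope ring_scope.

(** With [C = ~: J], faces are pairs of [I] in [K] and [C] not in [K] with [I] inside [C], of weight
    [w ^+ #|C :\: I|]. For fixed [I], all supersets [C] together give the first sum; those in [K]
    must be subtracted. *)
Lemma sum_bier (R : comNzRingType) (w : R) : simplicial_complex K ->
  \sum_(F in bier K) w ^+ (m - #|F|) =
  \sum_(C in K) (1 + w) ^+ (m - #|C|) - \sum_(C in K) (1 + w) ^+ #|C|.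
Proof.
move=> [_ Kdown]; rewrite bierE big_imset /=; last by move=> ? ? _ _ /bier_face_inj.
rewrite (eq_bigl (fun p : {set 'I_m} * {set 'I_m} => (p.1 \in K) &&
   ((~: p.2 \notin K) && [disjoint p.1 & p.2]))); last by move=> p; rewrite inE.
rewrite -(pair_big_dep (fun I => I \in K)
   (fun I J => (~: J \notin K) && [disjoint I & J])
   (fun I J => w ^+ (m - #|bier_face (I, J)|))) /=.
have subsum C : (1 + w) ^+ #|C| = \sum_(I : {set 'I_m} | I \subset C) w ^+ #|C :\: I|.
  by rewrite -sum_subset_expr; apply: eq_bigr => I _; rewrite expr1n mul1r.
have card_compl I J : [disjoint I & J] ->
    (m - #|bier_face (I, J)| = #|~: J| - #|I|)%N.
  by move=> dIJ; rewrite card_bier_face card_setC; lia.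
(* The subtracted pairs are summed over [I] first: every subset of a face [C] is itself in [K], so
   the inner sum is a full binomial expansion. *)
have -> : \sum_(C in K) (1 + w) ^+ #|C| =
    \sum_(I in K) \sum_(J | (~: J \in K) && [disjoint I & J])
       w ^+ (m - #|bier_face (I, J)|).
  rewrite (exchange_big_dep (fun J => ~: J \in K)) /=; last by move=> I J _ /andP[].
  rewrite (reindex_inj (inv_inj (@setCK _))) /=; apply: eq_bigr => J JK.
  rewrite subsum; apply: eq_big => I.
    rewrite JK /= disjoints_subset; case: (boolP (I \subset _)) => IJ; rewrite ?andbF //.
    by rewrite (Kdown _ _ IJ JK).
  by move=> IJ; rewrite card_compl ?disjoints_subset // cardsDS.
rewrite -sumrB; apply: eq_bigr => I IK.
have -> : (m - #|I| = #|~: I|)%N by rewrite card_setC.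
rewrite subsum; apply/esym/eqP; rewrite subr_eq; apply/eqP.
rewrite [LHS](eq_bigl (fun J => [disjoint I & J])); last first.
  by move=> J; rewrite disjoint_sym disjoints_subset.
rewrite [LHS](bigID (fun J => ~: J \in K)) /= addrC; congr (_ + _).
  apply: eq_big => J; first by rewrite andbC.
  move=> /andP[dIJ _]; rewrite card_bier_face cardsDS ?card_setC ?subnDA //.
  by rewrite -disjoints_subset disjoint_sym.
apply: eq_big => J; first by rewrite andbC.
move=> /andP[dIJ _]; rewrite card_bier_face cardsDS ?card_setC ?subnDA //.
by rewrite -disjoints_subset disjoint_sym.
Qed.
End Sum.

(** The inclusion of [I] in [~: J] is strict, since only the former is in [K]. *)
Lemma card_bier F : F \in bier K -> #|F| < m.
Proof.
rewrite bierE => /imsetP[[I J]]; rewrite inE /= => /and3P[IK JK dIJ] ->.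
rewrite card_bier_face; have := subset_leq_card (_ : I \subset ~: J).
rewrite -disjoints_subset => /(_ dIJ).
have eJ : #|J| + #|~: J| = m by rewrite cardsC card_ord.
rewrite leq_eqVlt => /orP[/eqP eIJ|]; last by lia.
have eI : I = ~: J by apply/eqP; rewrite eqEcard -disjoints_subset dIJ eIJ /=.
by rewrite -eI IK in JK.
Qed.

Lemma proper_setT : simplicial_complex K -> K <> powerset [set: 'I_m] ->
  [set: 'I_m] \notin K.
Proof.
move=> [_ Kdown] Kfull; apply/negP => TK; apply: Kfull; apply/setP=> C.
by rewrite powersetE subsetT; apply: Kdown (subsetT C) TK.
Qed.

Lemma rank_bier : simplicial_complex K -> K <> powerset [set: 'I_m] ->
  rank (bier K) = m.-1.
Proof.
move=> Kc Kfull; have [K0 Kdown] := Kc.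
apply/eqP; rewrite eqn_leq; apply/andP; split.
  by apply/bigmax_leqP => F /card_bier; lia.
have TK := proper_setT Kc Kfull.
have [I [IK maxI]] : exists I, I \in K /\ forall v, v \notin I -> v |: I \notin K.
  have [I /maxsetP[IK maxI] _] := maxset_exists (P := fun G => G \in K) K0.
  exists I; split => // v vI; apply: contra vI => vIK.
  by rewrite -(maxI _ vIK (subsetUr _ _)) setU11.
have [v vI] : exists v, v \notin I.
  have /subsetPn[v _ vI] : ~~ ([set: 'I_m] \subset I).
    by apply: contra TK => /Kdown; apply.
  by exists v.
(* Adding [v] to the maximal face [I] leaves [K], so this is a face; it omits only the index [v] and
   thus has [m - 1] elements. *)
have FK : bier_face (I, ~: (v |: I)) \in bier K.
  rewrite mem_bier IK setCK maxI //=.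
  by rewrite disjoints_subset setCK subsetUr.
have := leq_bigmax_cond (F := fun F : {set 'I_m + 'I_m} => #|F|) _ FK.
have := cardsC (v |: I); rewrite card_ord cardsU1 vI.
rewrite card_bier_face => eIm; apply: leq_trans; lia.
Qed.

(** Flagness is applied to [I] paired with the empty set; since the full set is not in [K], such a
    pair is a face exactly when its first part is in [K]. *)
Lemma flag_bier_nonface I : flag_complex (bier K) -> [set: 'I_m] \notin K ->
  I \notin K -> exists u v, [/\ u \in I, v \in I & [set u; v] \notin K].
Proof.
move=> fl TK IK.
have : bier_face (I, set0) \notin bier K by rewrite mem_bier (negbTE IK).
move=> /(flag_nonface fl)[a [b [aF bF abK]]].
have memF x : x \in bier_face (I, set0) -> exists2 u, u \in I & x = inl u.
  by rewrite inE imset0 inE orbF => /imsetP[u uI ->]; exists u.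
have [u uI ea] := memF a aF; have [v vI eb] := memF b bF.
exists u, v; split=> //; apply: contra abK => uvK.
have -> : [set a; b] = bier_face ([set u; v], set0).
  by rewrite /bier_face imset0 setU0 imsetU !imset_set1 ea eb.
by rewrite mem_bier uvK setC0 TK disjoints_subset setC0 subsetT.
Qed.

(** The dual argument: the empty set paired with the copy of [~: I] is a non-face because [I] is in
    [K]. *)
Lemma flag_bier_cofacet I : flag_complex (bier K) -> set0 \in K ->
  I \in K -> exists u v, [/\ u \notin I, v \notin I & ~: [set u; v] \in K].
Proof.
move=> fl K0 IK.
have : bier_face (set0, ~: I) \notin bier K by rewrite mem_bier setCK IK andbF.
move=> /(flag_nonface fl)[a [b [aF bF abK]]].
have memF x : x \in bier_face (set0, ~: I) -> exists2 u, u \notin I & x = inr u.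
  by rewrite inE imset0 inE => /imsetP[u]; rewrite inE => uI ->; exists u.
have [u uI ea] := memF a aF; have [v vI eb] := memF b bF.
exists u, v; split=> //; apply: contraR abK => uvK.
have -> : [set a; b] = bier_face (set0, [set u; v]).
  by rewrite /bier_face imset0 set0U imsetU !imset_set1 ea eb.
by rewrite mem_bier K0 uvK disjoints_subset sub0set.
Qed.
End Bier.

(** * Classification of the possible graphs by their small vertex covers *)

Section Classification.
Local Open Scope ring_scope.

(* The truncated n - 2 matters only for n < 2, where g is always 0. *)
Definition gamma_poly n g : {poly int} :=
  (1 + 'X) ^+ n + g%:R * 'X * (1 + 'X) ^+ (n - 2).

(* The entries of es index positions in the support sequence; (i, i) is a loop. *)
Definition edge_free (es : seq (nat * nat)) (b : seq bool) : bool :=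
  ~~ has (fun e => nth false b e.1 && nth false b e.2) es.

(** The counterpart of [bier_gamma] for the graph [es] on [k] vertices alone: for concrete [es] and
    [g], an explicit polynomial identity that [ring] can check. *)
Definition supported_gamma k es g : Prop :=
  (2 < k)%N || (g == 0)%N /\
  bit_sum 1 ('X : {poly int}) k (edge_free es) - bit_sum 'X 1 k (edge_free es) =
    ('X - 1) * gamma_poly k.-1 g.

Variables (m : nat) (K : {set {set 'I_m}}).
Implicit Types (u v p q r s : 'I_m) (C : {set 'I_m}).

(* By sum_bier at w = X - 1, the difference of sums is (X - 1) times the
   h-polynomial of bier K. *)
Definition bier_gamma g : Prop :=
  (2 < m)%N || (g == 0)%N /\
  \sum_(C in K) 'X ^+ (m - #|C|) - \sum_(C in K) 'X ^+ #|C| =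
    ('X - 1) * gamma_poly m.-1 g.

(** Both sums acquire the factor [(1 + 'X) ^+ (m - size s)], which also raises the exponents in
    [gamma_poly] from the support to all of [[m]]. *)
Lemma bier_gamma_support (s : seq 'I_m) es g : uniq s -> (0 < size s)%N ->
  (forall C, (C \in K) = edge_free es [seq x \in C | x <- s]) ->
  supported_gamma (size s) es g -> bier_gamma g.
Proof.
move=> us s_gt0 KE [gs eqs].
have sm : (size s <= m)%N by rewrite -(card_uniqP us) -[m in leqRHS]card_ord max_card.
split; first by case/orP: gs => [ltk|->]; rewrite ?orbT // (leq_trans ltk).
have sumE (y z : {poly int}) : \sum_(C in K) y ^+ #|C| * z ^+ (m - #|C|) =
    (y + z) ^+ (m - size s) * bit_sum y z (size s) (edge_free es).
  have /= := sum_subset_support (U := setT) (edge_free es) y z us.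
  rewrite cardsT card_ord => <- //; apply: eq_big => C; rewrite ?subsetT ?KE //.
  by rewrite setTD card_setC.
have := sumE 1 'X; have := sumE 'X 1.
rewrite (eq_bigr (fun C => 'X ^+ #|C|)); last by move=> C _; rewrite expr1n mulr1.
move=> ->; rewrite (eq_bigr (fun C => 'X ^+ (m - #|C|))); last first.
  by move=> C _; rewrite expr1n mul1r.
move=> ->; rewrite ['X + 1]addrC -mulrBr eqs mulrCA; congr (_ * _).
rewrite /gamma_poly mulrDr mulrCA -!exprD.
have -> : (m - size s + (size s).-1 = m.-1)%N by lia.
(* The exponents [n - 2] add up correctly only without truncation, hence the side condition. *)
congr (_ + _); case/orP: gs => [ltk|/eqP->]; last by rewrite !mul0r.
by congr (_ * _ ^+ _); lia.
Qed.

Hypotheses (K0 : set0 \in K)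
  (Kdown : forall F G : {set 'I_m}, F \subset G -> G \in K -> F \in K)
  (TK : [set: 'I_m] \notin K)
  (nonfaceP : forall C, C \notin K ->
     exists u v, [/\ u \in C, v \in C & [set u; v] \notin K])
  (cofacetP : forall C, C \in K ->
     exists u v, [/\ u \notin C, v \notin C & ~: [set u; v] \in K]).

(* E u u says that u is a ghost vertex. *)
Let E u v := [set u; v] \notin K.

(** The list need only contain the inclusion-minimal edges: a set is a non-face exactly when it
    contains an edge, hence a listed one. An edge meeting a loop need not be listed. *)
Lemma bier_gamma_edges x0 (s : seq 'I_m) es g : uniq s -> (0 < size s)%N ->
  all (fun e => [&& e.1 < size s, e.2 < size s & E (nth x0 s e.1) (nth x0 s e.2)]%N)
    es ->
  (forall u v, E u v -> has (fun e =>
     (nth x0 s e.1 \in [set u; v]) && (nth x0 s e.2 \in [set u; v])) es) ->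
  supported_gamma (size s) es g -> bier_gamma g.
Proof.
move=> us s_gt0 /allP esE Ees; apply: bier_gamma_support => // C.
apply/idP/hasPn => [CK e /esE /and3P[lt1 lt2]|esC].
  rewrite !(nth_map x0) //; apply: contra => /andP[e1 e2].
  by apply: Kdown CK; rewrite subUset !sub1set e1.
apply: contraT => /nonfaceP[u [v [uC vC /Ees/hasP[e ee /andP[e1 e2]]]]].
have uvC : [set u; v] \subset C by rewrite subUset !sub1set uC.
have /and3P[lt1 lt2 _] := esE e ee.
by have := esC e ee; rewrite !(nth_map x0) // !(subsetP uvC).
Qed.

Lemma EC u v : E u v = E v u. Proof. by rewrite /E setUC. Qed.

Lemma edge_sub x y u v : x != y -> E u v ->
  x \in [set u; v] -> y \in [set u; v] -> E x y.
Proof.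
move=> nxy Euv; rewrite !inE => /orP[]/eqP ex /orP[]/eqP ey; subst x y => //.
- by rewrite eqxx in nxy.
- by rewrite EC.
- by rewrite eqxx in nxy.
Qed.

(** An edge avoiding [p] and [q] would be a non-face inside a face, so [p] and [q] form a vertex
    cover. *)
Lemma cover_edge p q : ~: [set p; q] \in K -> forall u v, E u v ->
  (p \in [set u; v]) || (q \in [set u; v]).
Proof.
move=> pqK u v; apply: contraR; rewrite negb_or => /andP[np nq].
apply: Kdown pqK; apply/subsetP=> x xuv; rewrite !inE.
by apply/norP; split; [apply: contraNneq np => <-|apply: contraNneq nq => <-].
Qed.

Lemma edge_exists : exists u v, E u v.
Proof. by have [u [v [_ _ uvK]]] := nonfaceP TK; exists u, v. Qed.

Ltac sgamma := split=> //; rewrite /gamma_poly /bit_sum /edge_free /=; ring.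

Lemma bier_gamma_loops p q : ~: [set p; q] \in K -> E p p -> E q q ->
  exists g, bier_gamma g.
Proof.
move=> /cover_edge cpq Ep Eq; exists 0%N; have [epq|npq] := eqVneq p q.
  apply: (bier_gamma_edges (x0 := p) (s := [:: p]) (es := [:: (0, 0)]%N)) => //=.
  - by rewrite Ep.
  - by move=> u v /cpq; rewrite -epq andbb orbb orbF.
  - sgamma.
apply: (bier_gamma_edges (x0 := p) (s := [:: p; q]) (es := [:: (0, 0); (1, 1)]%N)) => //=.
- by rewrite inE npq.
- by rewrite Ep Eq.
- by move=> u v /cpq; rewrite !andbb orbF.
- sgamma.
Qed.

Lemma bier_gamma_loop p q : ~: [set p; q] \in K -> E p p -> ~~ E q q ->
  exists g, bier_gamma g.
Proof.
move=> /cover_edge cpq Ep; rewrite /E setUid negbK => qK.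
have [u [v [uq vq cuv]]] := cofacetP qK.
(* A cover avoiding [q] must contain [p] because of the loop; [t] is its other element, possibly [p]
   again. *)
have [t nqt cpt] : exists2 t, q != t & ~: [set p; t] \in K.
  have := cover_edge cuv Ep; rewrite !inE !orbb in uq vq *.
  by case/orP => /eqP eu; [exists v|exists u]; rewrite 1?eq_sym -?eu // setUC.
have {}cpt := cover_edge cpt.
have npq : p != q by apply: contraNneq Ep => ->; rewrite setUid.
(* An edge avoiding [p] contains both [q] and [t], so [q t] is the only possible edge besides those
   through the loop. *)
have [Eqt|nE] := boolP (E q t && (t != p)).
  case/andP: Eqt => Eqt ntp; exists 1%N.
  apply: (bier_gamma_edges (x0 := p) (s := [:: p; q; t]) (es := [:: (0, 0); (1, 2)]%N)) => //=.
  - by rewrite !inE negb_or npq eq_sym ntp nqt.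
  - by rewrite Ep Eqt.
  - by move=> u' v' Euv; move: (cpq _ _ Euv) (cpt _ _ Euv); do 3!case: (_ \in _).
  - sgamma.
exists 0%N; apply: (bier_gamma_edges (x0 := p) (s := [:: p]) (es := [:: (0, 0)]%N)) => //=.
- by rewrite Ep.
- move=> u' v' Euv; move: (cpq _ _ Euv) (cpt _ _ Euv); rewrite andbb orbF.
  case: (boolP (p \in _)) => //= np qin tin; move: nE.
  rewrite (edge_sub nqt Euv qin tin) negbK /= => /eqP tp; by rewrite -tp tin in np.
- sgamma.
Qed.

(** As [p] and [q] span a face, some cover [r], [s] avoids both. Every edge then joins one cover to
    the other, so the graph is bipartite with parts of size at most two. *)
Lemma bier_gamma_nonadjacent p q : ~: [set p; q] \in K -> ~~ E p q ->
  exists g, bier_gamma g.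
Proof.
move=> /cover_edge cpq; rewrite negbK => pqK.
have [r [s [rpq spq /cover_edge crs]]] := cofacetP pqK.
move: rpq spq; rewrite !inE !negb_or => /andP[nrp nrq] /andP[nsp nsq].
have [u0 [v0 Euv0]] := edge_exists.
have sub x y u v : y != x -> E u v -> x \in [set u; v] -> y \in [set u; v] -> E x y.
  by rewrite eq_sym; apply: edge_sub.
pose es (i j : nat) (b : bool) := if b then [:: (i, j)] else [::].
have [epq|npq] := eqVneq p q; have [ers|nrs] := eqVneq r s.
- exists 0%N; apply: (bier_gamma_edges (x0 := p) (s := [:: p; r]) (es := [:: (0, 1)]%N)) => //=.
  + by rewrite inE eq_sym nrp.
  + move: (cpq _ _ Euv0) (crs _ _ Euv0); rewrite -epq -ers !orbb => pin rin.
    by rewrite (sub _ _ _ _ _ Euv0).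
  + by move=> u v Euv; move: (cpq _ _ Euv) (crs _ _ Euv); rewrite -epq -ers !orbb => -> ->.
  + sgamma.
(* The graph is a star centred at [p], with one or two edges. *)
- exists (E p r + E p s).-1.
  apply: (bier_gamma_edges (x0 := p) (s := [:: p; r; s])
    (es := es 0 1 (E p r) ++ es 0 2 (E p s))%N) => //=.
  + by rewrite !inE negb_or eq_sym nrp eq_sym nsp nrs.
  + by rewrite all_cat /es; case: ifP => Epr; case: ifP => Eps; rewrite /= ?Epr ?Eps.
  + move=> u v Euv; move: (cpq _ _ Euv) (crs _ _ Euv); rewrite -epq orbb has_cat => pin.
    by case/orP => xin; [rewrite (sub _ _ _ _ nrp Euv)|rewrite (sub _ _ _ _ nsp Euv)];
      rewrite //= pin xin ?orbT.
  + have : E p r || E p s.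
      move: (cpq _ _ Euv0) (crs _ _ Euv0); rewrite -epq orbb => pin /orP[] xin.
        by rewrite (sub _ _ _ _ nrp Euv0).
      by rewrite (sub _ _ _ _ nsp Euv0) ?orbT.
    rewrite /es; case: (E p r); case: (E p s) => //= _; sgamma.
- exists (E p r + E q r).-1.
  apply: (bier_gamma_edges (x0 := p) (s := [:: p; q; r])
    (es := es 0 2 (E p r) ++ es 1 2 (E q r))%N) => //=.
  + by rewrite !inE negb_or npq eq_sym nrp eq_sym nrq.
  + by rewrite all_cat /es; case: ifP => Epr; case: ifP => Eqr; rewrite /= ?Epr ?Eqr.
  + move=> u v Euv; move: (cpq _ _ Euv) (crs _ _ Euv); rewrite -ers orbb has_cat.
    by case/orP => xin rin; [rewrite (sub _ _ _ _ nrp Euv)|rewrite (sub _ _ _ _ nrq Euv)];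
      rewrite //= rin xin ?orbT.
  + have : E p r || E q r.
      move: (cpq _ _ Euv0) (crs _ _ Euv0); rewrite -ers orbb => /orP[] xin rin.
        by rewrite (sub _ _ _ _ nrp Euv0).
      by rewrite (sub _ _ _ _ nrq Euv0) ?orbT.
    rewrite /es; case: (E p r); case: (E q r) => //= _; sgamma.
(* A perfect matching gives 2. Without one there are at most two edges, sharing a vertex if there
   are two, and [g] is their number minus one. *)
exists (if (E p r && E q s) || (E p s && E q r) then 2
  else (E p r + E p s + E q r + E q s).-1)%N.
apply: (bier_gamma_edges (x0 := p) (s := [:: p; q; r; s])
  (es := es 0 2 (E p r) ++ es 0 3 (E p s) ++ es 1 2 (E q r) ++ es 1 3 (E q s))%N) => //=.
+ by rewrite !inE !negb_or npq ![p == _]eq_sym ![q == _]eq_sym nrp nrq nsp nsq nrs.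
+ rewrite !all_cat /es; case: ifP => Epr; case: ifP => Eps; case: ifP => Eqr; case: ifP => Eqs;
    by rewrite /= ?Epr ?Eps ?Eqr ?Eqs.
+ move=> u v Euv; rewrite !has_cat.
  case/orP: (cpq _ _ Euv) => xin; case/orP: (crs _ _ Euv) => yin.
  * by rewrite (sub _ _ _ _ nrp Euv) //= xin yin.
  * by rewrite (sub _ _ _ _ nsp Euv) //= xin yin ?orbT.
  * by rewrite (sub _ _ _ _ nrq Euv) //= xin yin ?orbT.
  * by rewrite (sub _ _ _ _ nsq Euv) //= xin yin ?orbT.
+ have : [|| E p r, E p s, E q r | E q s].
    case/orP: (cpq _ _ Euv0) => xin; case/orP: (crs _ _ Euv0) => yin.
    * by rewrite (sub _ _ _ _ nrp Euv0).
    * by rewrite (sub _ _ _ _ nsp Euv0) ?orbT.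
    * by rewrite (sub _ _ _ _ nrq Euv0) ?orbT.
    * by rewrite (sub _ _ _ _ nsq Euv0) ?orbT.
  rewrite /es; case: (E p r); case: (E p s); case: (E q r); case: (E q s) => //= _; sgamma.
Qed.

(** A cover avoiding [p] contains [q], and conversely, which yields covers [q], [r] and [p], [t].
    Together with [p], [q] they leave only the edges [p q], [p r] and [q t], and [g] counts the
    edges other than [p q]. *)
Lemma bier_gamma_adjacent p q : ~: [set p; q] \in K -> E p q ->
  ~~ E p p -> ~~ E q q -> exists g, bier_gamma g.
Proof.
move=> /cover_edge cpq Epq nEp nEq.
have npq : p != q by apply: contraNneq nEp => {2}->.
have other x y : E x y -> ~~ E x x ->
    exists2 r, r != x & forall u v, E u v -> (r \in [set u; v]) || (y \in [set u; v]).
  move=> Exy; rewrite negbK setUid => /cofacetP[a [b [ax bx /cover_edge cab]]].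
  have := cab _ _ Exy; rewrite !inE in ax bx *; rewrite (negbTE ax) (negbTE bx) /=.
  case/orP => /eqP ey; [exists b|exists a] => // u v /cab; rewrite -ey //.
  by rewrite orbC.
have [r nrp crq] := other _ _ Epq nEp.
have [t ntq ctp] := other _ _ (etrans (EC q p) Epq) nEq.
have npr : p != r by rewrite eq_sym.
have nqt : q != t by rewrite eq_sym.
have edgeP u v : E u v -> [|| (p \in [set u; v]) && (q \in [set u; v]),
    [&& E p r, r != q, p \in [set u; v] & r \in [set u; v]] |
    [&& E q t, t != p, q \in [set u; v] & t \in [set u; v]]].
  move=> Euv; move: (cpq _ _ Euv) (crq _ _ Euv) (ctp _ _ Euv).
  have [pin|pin] := boolP (p \in _); have [qin|qin] //= := boolP (q \in _).
    rewrite orbF => _ rin _; rewrite rin (edge_sub npr Euv pin rin) /= andbT.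
    by rewrite !andbF orbF; apply: contraNneq qin => <-.
  rewrite orbF => _ _ tin; rewrite tin (edge_sub nqt Euv qin tin) /= andbT.
  by rewrite !andbF; apply: contraNneq pin => <-.
case: (boolP (E p r && (r != q))) => [/andP[Epr nrq]|nEpr];
  case: (boolP (E q t && (t != p))) => [/andP[Eqt ntp]|nEqt].
(* The graph is a triangle if [r = t], and otherwise the path [r], [p], [q], [t]. *)
- exists 2; have [ert|nrt] := eqVneq r t.
    apply: (bier_gamma_edges (x0 := p) (s := [:: p; q; r])
      (es := [:: (0, 1); (0, 2); (1, 2)]%N)) => //=.
    + by rewrite !inE negb_or npq eq_sym nrp eq_sym nrq.
    + by rewrite Epq Epr ert Eqt.
    + move=> u v /edgeP; rewrite -ert orbF.
      by case/or3P => [->|/and4P[_ _ -> ->]|/and4P[_ _ -> ->]]; rewrite ?orbT.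
    + sgamma.
  apply: (bier_gamma_edges (x0 := p) (s := [:: p; q; r; t])
      (es := [:: (0, 1); (0, 2); (1, 3)]%N)) => //=.
  + by rewrite !inE !negb_or npq ![p == _]eq_sym ![q == _]eq_sym nrp nrq ntp ntq nrt.
  + by rewrite Epq Epr Eqt.
  + move=> u v /edgeP; rewrite orbF.
    by case/or3P => [->|/and4P[_ _ -> ->]|/and4P[_ _ -> ->]]; rewrite ?orbT.
  + sgamma.
- exists 1; apply: (bier_gamma_edges (x0 := p) (s := [:: p; q; r])
      (es := [:: (0, 1); (0, 2)]%N)) => //=.
  + by rewrite !inE negb_or npq eq_sym nrp eq_sym nrq.
  + by rewrite Epq Epr.
  + move=> u v /edgeP; rewrite orbF.
    case/or3P => [->|/and4P[_ _ -> ->]|/and4P[Eqt ntp _ _]]; rewrite ?orbT //.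
    by rewrite Eqt ntp in nEqt.
  + sgamma.
- exists 1; apply: (bier_gamma_edges (x0 := p) (s := [:: p; q; t])
      (es := [:: (0, 1); (1, 2)]%N)) => //=.
  + by rewrite !inE negb_or npq eq_sym ntp eq_sym ntq.
  + by rewrite Epq Eqt.
  + move=> u v /edgeP; rewrite orbF.
    case/or3P => [->|/and4P[Epr nrq _ _]|/and4P[_ _ -> ->]]; rewrite ?orbT //.
    by rewrite Epr nrq in nEpr.
  + sgamma.
- exists 0; apply: (bier_gamma_edges (x0 := p) (s := [:: p; q])
      (es := [:: (0, 1)]%N)) => //=.
  + by rewrite inE npq.
  + by rewrite Epq.
  + move=> u v /edgeP; rewrite orbF.
    case/or3P => [->|/and4P[Epr nrq _ _]|/and4P[Eqt ntp _ _]] //.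
      by rewrite Epr nrq in nEpr.
    by rewrite Eqt ntp in nEqt.
  + sgamma.
Qed.

Lemma bier_gamma_exists : exists g, bier_gamma g.
Proof.
have [p [q [_ _ cpq]]] := cofacetP K0.
have [Ep|nEp] := boolP (E p p); have [Eq|nEq] := boolP (E q q).
- exact: bier_gamma_loops cpq Ep Eq.
- exact: bier_gamma_loop cpq Ep nEq.
- by rewrite setUC in cpq; apply: bier_gamma_loop cpq Eq nEp.
have [Epq|nEpq] := boolP (E p q).
  exact: bier_gamma_adjacent cpq Epq nEp nEq.
exact: bier_gamma_nonadjacent cpq nEpq.
Qed.
End Classification.

(** * From the polynomial identity to the gamma-vector *)

Section GammaVector.
Local Open Scope ring_scope.

Lemma coef_1DX_exp n j : ((1 + 'X : {poly int}) ^+ n)`_j = 'C(n, j)%:R.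
Proof.
rewrite exprDn coef_sum.
under eq_bigr => i _ do rewrite expr1n mul1r coefMn coefXn.
have [ltjn|ltnj] := ltnP j n.+1.
  rewrite (bigD1 (Ordinal ltjn)) //= eqxx big1 ?addr0 // => i ne_i.
  by rewrite (_ : (j == i) = false) ?mul0rn //; apply/negbTE; rewrite eq_sym.
rewrite bin_small // big1 // => i _; rewrite (_ : (j == i) = false) ?mul0rn //.
by have := ltn_ord i; lia.
Qed.

(** Bridges two conventions: [h_num] reads its entry [i] in degree [n - i], while [gamma_vector]
    places it in degree [i]. *)
Definition reversal n (p : {poly int}) : {poly int} := \poly_(i < n.+1) p`_(n - i).

Lemma reversal_gamma_term n i : (i.*2 <= n)%N ->
  reversal n ('X^i * (1 + 'X) ^+ (n - i.*2)) = 'X^i * (1 + 'X) ^+ (n - i.*2).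
Proof.
move=> le_in; apply/polyP => j; rewrite coef_poly !coefXnM !coef_1DX_exp.
case: ltnP => ltjn; last first.
  by case: ltnP => // leij; rewrite bin_small //; lia.
have [lt1|le1] := ltnP (n - j) i; have [lt2|le2] := ltnP j i => //.
- by rewrite bin_small //; lia.
- by rewrite bin_small //; lia.
- by rewrite -[in LHS]bin_sub; [congr 'C(_, _)%:R|]; lia.
Qed.

Lemma reversalD n p q : reversal n (p + q) = reversal n p + reversal n q.
Proof. by apply/polyP => j; rewrite coefD !coef_poly coefD; case: ifP; rewrite ?addr0. Qed.

Lemma reversal_natM n g p : reversal n (g%:R * p) = g%:R * reversal n p.
Proof.
apply/polyP => j; rewrite !mulr_natl coefMn !coef_poly coefMn.
by case: ifP; rewrite ?mul0rn.
Qed.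

Lemma reversal_gamma_poly n g : (1 < n)%N || (g == 0)%N ->
  reversal n (gamma_poly n g) = gamma_poly n g.
Proof.
have r0 : reversal n ((1 + 'X) ^+ n) = (1 + 'X) ^+ n.
  by have := @reversal_gamma_term n 0 isT; rewrite expr0 mul1r subn0.
rewrite /gamma_poly -mulrA reversalD reversal_natM r0.
case/orP => [lt1n|/eqP->]; last by rewrite !mul0r.
by congr (_ + _ * _); apply: (@reversal_gamma_term n 1).
Qed.

(** Only the terms 0 and 1 survive, as [points g] has f-vector [(1, g)]; for [n < 2] term 1 is out
    of range, but then [g] is 0. *)
Lemma gamma_polyE n g : (1 < n)%N || (g == 0)%N ->
  gamma_poly n g =
    \sum_(i < n./2.+1) Posz (fnum (points g) i) *: ('X^i * (1 + 'X) ^+ (n - i.*2)).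
Proof.
rewrite /gamma_poly big_ord_recl fnum_points expr0 mul1r subn0 scale1r.
case/orP => [lt1n|/eqP->].
  have -> : (n./2 = n./2.-1.+1)%N by lia.
  rewrite big_ord_recl fnum_points big1 ?addr0 => [|i _]; last first.
    by rewrite fnum_points scale0r.
  by rewrite /= -mulrA -[Posz g]natz scaler_nat mulr_natl.
rewrite big1 ?mul0r // => i _; rewrite fnum_points.
by rewrite lift0 /=; case: (nat_of_ord i) => [|?]; rewrite scale0r.
Qed.

Lemma sum_fnum (V : finType) (L : {set {set V}}) (f : nat -> {poly int}) :
  \sum_(k < (rank L).+1) (fnum L k)%:R *: f k = \sum_(F in L) f #|F|.
Proof.
have ltr F : F \in L -> (#|F| < (rank L).+1)%N.
  by move=> FL; have := leq_bigmax_cond (F := fun F : {set V} => #|F|) _ FL; apply.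
rewrite (partition_big (fun F : {set V} => inord #|F| : 'I_(rank L).+1) xpredT) //=.
apply: eq_bigr => k _; rewrite scaler_nat -sumr_const; apply: eq_big => F.
  rewrite inE; case: (boolP (F \in L)) => //= FL.
  by rewrite -(inj_eq val_inj) /= inordK ?ltr.
by rewrite inE => /andP[_ /eqP->].
Qed.

Lemma bier_gamma_vector m (K : {set {set 'I_m}}) g : (0 < m)%N ->
  simplicial_complex K -> K <> powerset [set: 'I_m] -> bier_gamma K g ->
  gamma_vector (bier K) (fun i => Posz (fnum (points g) i)).
Proof.
move=> m_gt0 Kc Kfull [gm eqK].
have gn : (1 < m.-1)%N || (g == 0)%N by move: gm; lia.
have eG : \sum_(F in bier K) ('X - 1 : {poly int}) ^+ (m.-1 - #|F|) =
    gamma_poly m.-1 g.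
  (* Multiplying by ['X - 1] turns each exponent [m.-1 - #|F|] into [m - #|F|], valid as [#|F| < m];
     then [sum_bier] applies with [w = 'X - 1]. *)
  apply: (mulfI (negbT (polyXsubC_eq0 1))).
  rewrite -eqK mulr_sumr.
  have -> : 'X = 1 + ('X - 1) :> {poly int} by ring.
  rewrite -sum_bier //; apply: eq_bigr => F /card_bier ltFm.
  by rewrite [1 + _]addrC addrK -exprS; congr (_ ^+ _); lia.
have := sum_fnum (bier K) (fun k => ('X - 1) ^+ (m.-1 - k)).
rewrite /gamma_vector /h_num (rank_bier Kc Kfull) eG => ->; split.
  (* The h-polynomial is the reversal of [gamma_poly], which is palindromic. *)
  by rewrite -gamma_polyE // -[RHS]reversal_gamma_poly // /reversal poly_def.
by move=> i lti; rewrite fnum_points; case: i lti gn => [|[|i]] //; lia.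
Qed.
End GammaVector.

Theorem corollary3p6 (m : nat) (K : {set {set 'I_m}}) (hm : 1 <= m)
    (hK : simplicial_complex K) (hK_full : K <> powerset [set: 'I_m])
    (h_flag : flag_complex (bier K)) :
  exists gamma : nat -> int,
    gamma_vector (bier K) gamma /\
    exists (V : finType) (Gamma : {set {set V}}),
      flag_complex Gamma /\
      forall i : nat, gamma i = Posz (fnum Gamma i).
Proof.
have TK := proper_setT hK hK_full; have [K0 Kdown] := hK.
have [g Kg] := bier_gamma_exists K0 Kdown TK
  (fun C => flag_bier_nonface h_flag TK) (fun C => flag_bier_cofacet h_flag K0).
exists (fun i => Posz (fnum (points g) i)).
split; first exact: bier_gamma_vector hm hK hK_full Kg.
by exists 'I_g, (points g); split=> //; apply: points_flag.
Qed.
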